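(* Let $\varepsilon>0$, $s_0>0$ and $s_1<0$. Let $f(x)=x^k$ for all $x\in\mathbb{R}$, for some $k\in\mathbb{N}$. Set $K^+=\widetilde K_\varepsilon(s_0)$, $K^-=\widehat K_\varepsilon(s_1)$ and $K=K^-\cup K^+$. Assume that the sequence of grids $(\mathbf{T}^{(n)})_{n\ge 1}$ is such that $\mathbf{T}^{(n)}\subset K$ for all $n\ge 1$, with $\mathbf{T}^{(1)}=\{t_1\}$ for some $t_1\in K$, and that $$\eta_n(K):=\sup_{x\in K}\inf_{t\in\mathbf{T}^{(n)}}|x-t|\xrightarrow[n\to\infty]{}0 .$$ Then, for every $n\in\mathbb{N}^*$, $$\int_{\mathbb{R}\setminus K^+}f^+(x)\,h^{(n)}(x)\,dx\le\frac{\varepsilon}{2},\qquad \int_{\mathbb{R}\setminus K^-}f^-(x)\,h^{(n)}(x)\,dx\le\frac{\varepsilon}{2}.$$ Moreover, there exists $n_0\in\mathbb{N}^*$ such that, for all $n\ge n_0$, $$\left|G^{(n)}\right|\le\varepsilon\left(1+\widetilde\mu(s_0)+|\widehat\mu(s_1)|+\sqrt{\frac{2\widehat\sigma(s_1)^2\widehat C(s_1)}{\varepsilon}}+\sqrt{\frac{2\widetilde\sigma(s_0)^2\widetilde C(s_0)}{\varepsilon}}\right).$$ In particular, $\lim_{n\to\infty}G^{(n)}=0$, $\lim_{n\to\infty}\overline{\mathcal I}^{(n)}=\mathcal I$ and $\lim_{n\to\infty}\underline{\mathcal I}^{(n)}=\mathcal I$.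
   Context: Let $\phi:\mathbb{R}\to\mathbb{R}$ be differentiable with (continuous) derivative $\dot\phi$, and $\pi(x)=\exp(-\phi(x))$. There are continuous functions $\beta,\nu:\mathbb{R}\to(0,+\infty)$ such that for all $t,x\in\mathbb{R}$, $$\phi(t)+\dot\phi(t)(x-t)+\tfrac{\nu(t)}{2}(x-t)^2\le\phi(x)\le\phi(t)+\dot\phi(t)(x-t)+\tfrac{\beta(t)}{2}(x-t)^2 .$$ The integral of interest is $\mathcal I=\int_{\mathbb{R}}f(x)\pi(x)\,dx$, assumed finite. Write $f^+(x)=\max\{f(x),0\}$ and $f^-(x)=\max\{-f(x),0\}$, and $g(x;\mu,\sigma)=\frac{1}{\sqrt{2\pi\sigma^2}}\exp(-(x-\mu)^2/(2\sigma^2))$ (where $\pi$ in the normalization is the usual constant). Gaussian tangent bounds: for $t\in\mathbb{R}$, $\underline\sigma(t)=1/\sqrt{\beta(t)}$, $\underline\mu(t)=t-\underline\sigma(t)^2\dot\phi(t)$, $\underline C(t)=\sqrt{2\pi\underline\sigma(t)^2}\exp\left(-\phi(t)+\frac{\underline\sigma(t)^2}{2}\dot\phi(t)^2\right)$, $\underline b(x;t)=\underline C(t)\,g(x;\underline\mu(t),\underline\sigma(t))$; and $\overline\sigma(t)=1/\sqrt{\nu(t)}$, $\overline\mu(t)=t-\overline\sigma(t)^2\dot\phi(t)$, $\overline C(t)=\sqrt{2\pi\overline\sigma(t)^2}\exp\left(-\phi(t)+\frac{\overline\sigma(t)^2}{2}\dot\phi(t)^2\right)$, $\overline b(x;t)=\overline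 C(t)\,g(x;\overline\mu(t),\overline\sigma(t))$. The sets of tangency points $\mathbf{T}^{(n)}$, $n\in\mathbb{N}^*=\{1,2,\dots\}$, are finite nonempty subsets of $\mathbb{R}$ with $\mathbf{T}^{(n)}\subset\mathbf{T}^{(n+1)}$. Envelopes: $\underline C(x;\mathbf{T}^{(n)})=\max_{t\in\mathbf{T}^{(n)}}\underline b(x;t)$, $\overline C(x;\mathbf{T}^{(n)})=\min_{t\in\mathbf{T}^{(n)}}\overline b(x;t)$, and $h^{(n)}(x)=\overline C(x;\mathbf{T}^{(n)})-\underline C(x;\mathbf{T}^{(n)})$. Integral bounds: $$\overline{\mathcal I}^{(n)}=\int_{\mathbb{R}}f^+(x)\overline C(x;\mathbf{T}^{(n)})dx-\int_{\mathbb{R}}f^-(x)\underline C(x;\mathbf{T}^{(n)})dx,$$ $$\underline{\mathcal I}^{(n)}=\int_{\mathbb{R}}f^+(x)\underline C(x;\mathbf{T}^{(n)})dx-\int_{\mathbb{R}}f^-(x)\overline C(x;\mathbf{T}^{(n)})dx,$$ and $G^{(n)}=\overline{\mathcal I}^{(n)}-\underline{\mathcal I}^{(n)}=\int_{\mathbb{R}}|f(x)|h^{(n)}(x)\,dx$. Parameters attached to the initial point $t_1$ and the power $k$: for $s>0$, $\widetilde\sigma(s)=\overline\sigma(t_1)$, $\widetilde\mu(s)=\overline\mu(t_1)+\frac{\overline\sigma(t_1)^2k}{s}$, $$\widetilde C(s)=\overline C(t_1)\frac{\widetilde\sigma(s)}{\overline\sigma(t_1)}\exp\left(-\frac{(s-\overline\mu(t_1))^2}{2\overline\sigma(t_1)^2}+k\ln(s)+\frac{\widetilde\sigma(s)^2}{2}\left(\frac{s-\overline\mu(t_1)}{\overline\sigma(t_1)^2}-\frac{k}{s}\right)^2\right);$$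 for $s<0$, $\widehat\sigma(s)=\overline\sigma(t_1)$, $\widehat\mu(s)=\overline\mu(t_1)+\frac{\overline\sigma(t_1)^2k}{s}$, $$\widehat C(s)=\overline C(t_1)\frac{\widehat\sigma(s)}{\overline\sigma(t_1)}\exp\left(-\frac{(-s+\overline\mu(t_1))^2}{2\overline\sigma(t_1)^2}+k\ln(-s)+\frac{\widehat\sigma(s)^2}{2}\left(\frac{-s+\overline\mu(t_1)}{\overline\sigma(t_1)^2}+\frac{k}{s}\right)^2\right).$$ Compact sets: for $s>0$, $\widetilde K_\varepsilon(s)=\left[0,\max\left(0,\widetilde\mu(s)+\widetilde\sigma(s)\sqrt{2\widetilde C(s)/\varepsilon}\right)\right]$; for $s<0$, $\widehat K_\varepsilon(s)=\left[\min\left(0,\widehat\mu(s)-\widehat\sigma(s)\sqrt{2\widehat C(s)/\varepsilon}\right),0\right]$.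
   Formalization: As printed, the f^+ tail bound fails for even k and the limits fail for one fixed ε. For even k the tail is bounded by ε/2 on [0,∞)\K^+ and on (-∞,0]\K^- separately; the limits are proved as ε→0, and for nested grids with η_n(K_ε)→0 for every ε>0. *)

(* Defs.v *)
From HB Require Import structures.
From mathcomp Require Import all_boot all_order all_algebra.
From mathcomp Require Import finmap.
From mathcomp Require Import all_classical all_reals all_analysis.

Set Implicit Arguments.
Unset Strict Implicit.
Unset Printing Implicit Defensive.

Import Order.TTheory GRing.Theory Num.Theory.
Import numFieldNormedType.Exports.

Local Open Scope classical_set_scope.
Local Open Scope ring_scope.

Section gaussian_tangent_bounds.
Context {R : realType}.
Implicit Types (phi beta nu curv f : R -> R) (t x s eps mu sigma C : R).
Implicit Types (T : nat -> {fset R}) (K : set R) (k n : nat).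

Definition target phi x : R := expR (- phi x).

(* One family serves both bounds: the lower tangent bound takes curv := beta,
   the upper one takes curv := nu. *)
Definition tangent_sigma curv t : R := (Num.sqrt (curv t))^-1.

Definition tangent_mu phi curv t : R :=
  t - tangent_sigma curv t ^+ 2 * derive1 phi t.

Definition tangent_C phi curv t : R :=
  Num.sqrt (2 * pi * tangent_sigma curv t ^+ 2) *
  expR (- phi t + tangent_sigma curv t ^+ 2 / 2 * derive1 phi t ^+ 2).

Definition tangent_bound phi curv t x : R :=
  tangent_C phi curv t *
  normal_pdf (tangent_mu phi curv t) (tangent_sigma curv t) x.

(* Maximum and minimum of F over a nonempty finite set. The initial value of
   the fold is itself one of the values of F on A, so it adds nothing; the
   empty set gives the irrelevant value F 0. *)
Definition fset_max (A : {fset R}) (F : R -> R) : R :=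
  \big[Num.max/F (head 0 (enum_fset A))]_(t <- enum_fset A) F t.

Definition fset_min (A : {fset R}) (F : R -> R) : R :=
  \big[Num.min/F (head 0 (enum_fset A))]_(t <- enum_fset A) F t.

Definition lower_envelope phi beta (A : {fset R}) x : R :=
  fset_max A (fun t => tangent_bound phi beta t x).

Definition upper_envelope phi nu (A : {fset R}) x : R :=
  fset_min A (fun t => tangent_bound phi nu t x).

Definition gap phi beta nu (A : {fset R}) x : R :=
  upper_envelope phi nu A x - lower_envelope phi beta A x.

Definition target_integral phi f : \bar R :=
  (\int[lebesgue_measure]_(x in [set: R]) (f x * target phi x)%:E)%E.

Definition upper_integral phi beta nu f (A : {fset R}) : \bar R :=
  (\int[lebesgue_measure]_(x in [set: R])
      (funrpos f x * upper_envelope phi nu A x)%:E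
   - \int[lebesgue_measure]_(x in [set: R])
      (funrneg f x * lower_envelope phi beta A x)%:E)%E.

Definition lower_integral phi beta nu f (A : {fset R}) : \bar R :=
  (\int[lebesgue_measure]_(x in [set: R])
      (funrpos f x * lower_envelope phi beta A x)%:E
   - \int[lebesgue_measure]_(x in [set: R])
      (funrneg f x * upper_envelope phi nu A x)%:E)%E.

Definition integral_gap phi beta nu f (A : {fset R}) : \bar R :=
  (upper_integral phi beta nu f A - lower_integral phi beta nu f A)%E.

(* For s > 0, tilde_C s times the normal density of parameters tilde_mu s and
   tilde_sigma dominates x ^ k times the upper tangent bound at t1 on x > 0,
   via ln x <= ln s + (x - s) / s; the hat parameters (s < 0) do the same for
   (- x) ^ k on x < 0. *)
Definition tilde_sigma nu t1 (s : R) : R := tangent_sigma nu t1.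

Definition tilde_mu phi nu k t1 s : R :=
  tangent_mu phi nu t1 + tangent_sigma nu t1 ^+ 2 * k%:R / s.

Definition tilde_C phi nu k t1 s : R :=
  let m := tangent_mu phi nu t1 in
  let v := tangent_sigma nu t1 ^+ 2 in
  tangent_C phi nu t1 * (tilde_sigma nu t1 s / tangent_sigma nu t1) *
  expR (- ((s - m) ^+ 2 / (2 * v)) + k%:R * ln s
        + tilde_sigma nu t1 s ^+ 2 / 2 * ((s - m) / v - k%:R / s) ^+ 2).

Definition hat_sigma nu t1 (s : R) : R := tangent_sigma nu t1.

Definition hat_mu phi nu k t1 s : R :=
  tangent_mu phi nu t1 + tangent_sigma nu t1 ^+ 2 * k%:R / s.

Definition hat_C phi nu k t1 s : R :=
  let m := tangent_mu phi nu t1 in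
  let v := tangent_sigma nu t1 ^+ 2 in
  tangent_C phi nu t1 * (hat_sigma nu t1 s / tangent_sigma nu t1) *
  expR (- ((- s + m) ^+ 2 / (2 * v)) + k%:R * ln (- s)
        + hat_sigma nu t1 s ^+ 2 / 2 * ((- s + m) / v + k%:R / s) ^+ 2).

Definition Kplus phi nu k t1 eps s : set R :=
  `[0, Num.max 0 (tilde_mu phi nu k t1 s + tilde_sigma nu t1 s *
                  Num.sqrt (2 * tilde_C phi nu k t1 s / eps))].

Definition Kminus phi nu k t1 eps s : set R :=
  `[Num.min 0 (hat_mu phi nu k t1 s - hat_sigma nu t1 s *
               Num.sqrt (2 * hat_C phi nu k t1 s / eps)), 0].

Definition Kset phi nu k t1 eps s0 s1 : set R :=
  Kminus phi nu k t1 eps s1 `|` Kplus phi nu k t1 eps s0.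

Definition dispersion (A : {fset R}) K : R :=
  sup [set inf [set `|x - t| | t in [set` A]] | x in K].

(* Grids are indexed from 1; the value T 0 is unconstrained. *)
Definition nested_grids t1 T : Prop :=
  [/\ T 1%N = [fset t1]%fset,
      forall n, (0 < n)%N -> T n != fset0 &
      forall n, (0 < n)%N -> (T n `<=` T n.+1)%fset].

Definition grids_filling K t1 T : Prop :=
  [/\ nested_grids t1 T,
      K t1,
      forall n, (0 < n)%N -> [set` T n] `<=` K &
      dispersion (T n) K @[n --> \oo] --> (0 : R)].

End gaussian_tangent_bounds.

(* Main.v *)
Require Import Defs.
From HB Require Import structures.
From mathcomp Require Import all_boot all_order all_algebra.
From mathcomp Require Import finmap.
From mathcomp Require Import all_classical all_reals all_analysis.
From mathcomp Require Import measurable_realfun.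
From mathcomp Require Import ring lra.

(* For x s >= 0 and s <> 0, the bound r <= exp (r - 1) at r = x / s turns
   |x|^k times the upper tangent bound at t1 into a multiple of a Gaussian
   density; its tail beyond the cutoff sqrt (2 C / eps) is at most eps / 2 by
   Chernoff's bound and exp y >= 2 y. The gap never exceeds the upper tangent
   bound at t1, so this controls the integral outside K for every grid. On K,
   the gap at x is at most the difference of the two tangent bounds at any grid
   point t, which tends to 0 as t tends to x; dominated convergence applies.
   Finally, both integral bounds lie within G of the target integral. *)

Set Implicit Arguments.
Unset Strict Implicit.
Unset Printing Implicit Defensive.

Import Order.TTheory GRing.Theory Num.Theory.
Import numFieldNormedType.Exports.

Local Open Scope classical_set_scope.
Local Open Scope ring_scope.

(** * Gaussian densities, closed form of the tangent bounds, and their products with powers *)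

Section gaussian_estimates.
Context {R : realType}.
Implicit Types (phi curv : R -> R) (t x s m a eps : R) (k : nat).

(** [expR y] is the square of [expR (y / 2)], which is at least [1 + y / 2], and
    [(1 + y / 2) ^+ 2 - 2 * y] is the square of [1 - y / 2]. *)
Lemma double_le_expR (y : R) : 0 <= y -> 2 * y <= expR y.
Proof.
move=> y0; have -> : expR y = expR (y / 2) ^+ 2.
  by rewrite expr2 -expRD; congr expR; lra.
have := expR_ge1Dx (y / 2); set e := expR _ => ye.
have : (1 + y / 2) ^+ 2 <= e ^+ 2 by rewrite ler_sqr ?nnegrE; lra.
by have := sqr_ge0 (1 - y / 2); lra.
Qed.

Lemma normal_pdf_expR m s x : 0 < s ->
  normal_pdf m s x = normal_peak s * expR (- (x - m) ^+ 2 / (2 * s ^+ 2)).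
Proof.
move=> s0; rewrite normal_pdfE ?gt_eqF// /normal_fun.
by rewrite -[s ^+ 2 *+ 2]mulr_natl.
Qed.

(* Chernoff's inequality, pointwise: past m + s a, the density is at most
   exp (- a^2 / 2) times its translate by s a. *)
Lemma normal_pdf_shift m s a x : 0 < s -> 0 <= (x - (m + s * a)) * a ->
  normal_pdf m s x <= expR (- (a ^+ 2 / 2)) * normal_pdf (m + s * a) s x.
Proof.
move=> s0 xa; rewrite !normal_pdf_expR// [leRHS]mulrCA.
apply: ler_wpM2l; first exact: normal_peak_ge0.
rewrite -expRD ler_expR -subr_ge0.
have -> : - (a ^+ 2 / 2) + - (x - (m + s * a)) ^+ 2 / (2 * s ^+ 2) -
    - (x - m) ^+ 2 / (2 * s ^+ 2) = (x - (m + s * a)) * a / s.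
  by field; lra.
by rewrite divr_ge0// ltW.
Qed.

Lemma tangent_sigma_gt0 curv t : 0 < curv t -> 0 < tangent_sigma curv t.
Proof. by move=> c0; rewrite invr_gt0 sqrtr_gt0. Qed.

Lemma tangent_sigma_sqr curv t : 0 < curv t ->
  tangent_sigma curv t ^+ 2 = (curv t)^-1.
Proof. by move=> c0; rewrite exprVn sqr_sqrtr// ltW. Qed.

Lemma tangent_C_gt0 phi curv t : 0 < curv t -> 0 < tangent_C phi curv t.
Proof.
move=> c0; rewrite mulr_gt0 ?expR_gt0// sqrtr_gt0.
by apply: mulr_gt0; [rewrite mulr_gt0 ?pi_gt0|rewrite exprn_gt0 ?tangent_sigma_gt0].
Qed.

(** The square root in [tangent_C] is the inverse of the peak of the density, so only the
    exponential survives. *)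
Lemma tangent_C_peak phi curv t : 0 < curv t ->
  tangent_C phi curv t * normal_peak (tangent_sigma curv t) =
  expR (- phi t + tangent_sigma curv t ^+ 2 / 2 * derive1 phi t ^+ 2).
Proof.
move=> c0; have s0 := tangent_sigma_gt0 c0.
rewrite /tangent_C /normal_peak; set s := tangent_sigma curv t.
have -> : s ^+ 2 * pi *+ 2 = 2 * pi * s ^+ 2.
  by rewrite -mulr_natl; ring.
rewrite mulrAC divff ?mul1r// gt_eqF// sqrtr_gt0.
by apply: mulr_gt0; [rewrite mulr_gt0 ?pi_gt0|rewrite exprn_gt0].
Qed.

(** Completing the square: the mean and variance are chosen so that the exponent is minus the
    quadratic of curvature [curv t] tangent to [phi] at [t]. *)
Lemma tangent_boundE phi curv t x : 0 < curv t ->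
  tangent_bound phi curv t x =
  expR (- (phi t + derive1 phi t * (x - t) + curv t / 2 * (x - t) ^+ 2)).
Proof.
move=> c0; rewrite /tangent_bound normal_pdf_expR ?tangent_sigma_gt0//.
rewrite mulrA tangent_C_peak// -expRD /tangent_mu tangent_sigma_sqr//.
by congr expR; field; lra.
Qed.

(** This is the tangent line inequality for [ln] at [s], multiplied by [k] and kept in exponential
    form so that [x = 0] is covered. The sign condition puts [x] on the side of [s], so both half
    lines are served. *)
Lemma exprn_norm_le s x k : s != 0 -> 0 <= x * s ->
  `|x| ^+ k <= expR (k%:R * ln `|s| + k%:R * ((x - s) / s)).
Proof.
move=> s0 xs; have ss : 0 < s ^+ 2 by rewrite exprn_even_gt0.
have r0 : 0 <= x / s.
  have -> : x / s = x * s / s ^+ 2 by field.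
  by rewrite divr_ge0// ltW.
have -> : `|x| = x / s * `|s|.
  by rewrite -{1}[x](divfK s0) normrM (ger0_norm r0).
rewrite exprMn expRD !expRM_natl lnK ?posrE ?normr_gt0// mulrC.
apply: ler_wpM2l; first exact: exprn_ge0.
have e : x / s <= expR ((x - s) / s).
  apply: le_trans (expR_ge1Dx _).
  by rewrite le_eqVlt; apply/orP; left; apply/eqP; field.
by rewrite lerXn2r ?nnegrE ?expR_ge0.
Qed.

(* The common form of tilde_C and hat_C. *)
Definition monomial_C phi nu k t1 s : R :=
  let m := tangent_mu phi nu t1 in
  let v := tangent_sigma nu t1 ^+ 2 in
  tangent_C phi nu t1 *
  expR (- ((s - m) ^+ 2 / (2 * v)) + k%:R * ln `|s|
        + v / 2 * ((s - m) / v - k%:R / s) ^+ 2).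

Lemma tilde_CE phi nu k t1 s : 0 < nu t1 -> 0 < s ->
  tilde_C phi nu k t1 s = monomial_C phi nu k t1 s.
Proof.
move=> n0 s0; rewrite /tilde_C /monomial_C /tilde_sigma gtr0_norm//.
by rewrite divff ?mulr1// gt_eqF// tangent_sigma_gt0.
Qed.

Lemma hat_CE phi nu k t1 s : 0 < nu t1 -> s < 0 ->
  hat_C phi nu k t1 s = monomial_C phi nu k t1 s.
Proof.
move=> n0 s0; rewrite /hat_C /monomial_C /hat_sigma ltr0_norm//=.
rewrite divff ?mulr1 ?gt_eqF ?tangent_sigma_gt0//.
have := tangent_sigma_gt0 n0; set v := tangent_sigma nu t1 => v0.
by congr (_ * expR _); field; rewrite lt_eqF// gt_eqF.
Qed.

Lemma monomial_C_gt0 phi nu k t1 s : 0 < nu t1 -> 0 < monomial_C phi nu k t1 s.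
Proof. by move=> n0; rewrite mulr_gt0 ?expR_gt0// tangent_C_gt0. Qed.

(** The exponential factor of slope [k / s] bounding the power shifts the mean of the Gaussian by
    [sigma ^+ 2 * k / s], from [tangent_mu] to [tilde_mu]; [monomial_C] collects the constants left
    by the square completion. *)
Lemma monomial_tangent_bound_le phi nu k t1 s x : 0 < nu t1 -> s != 0 ->
  0 <= x * s ->
  `|x| ^+ k * tangent_bound phi nu t1 x <=
  monomial_C phi nu k t1 s *
  normal_pdf (tilde_mu phi nu k t1 s) (tangent_sigma nu t1) x.
Proof.
move=> n0 s0 xs; have v0 := tangent_sigma_gt0 n0.
rewrite /tangent_bound /monomial_C !normal_pdf_expR//.
rewrite /tilde_mu; set m := tangent_mu _ _ _; set v := tangent_sigma _ _ in v0 *.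
rewrite mulrCA -mulrA; apply: ler_wpM2l; first by rewrite ltW// tangent_C_gt0.
rewrite mulrCA [leRHS]mulrCA; apply: ler_wpM2l; first exact: normal_peak_ge0.
apply: (le_trans (ler_wpM2r (expR_ge0 _) (exprn_norm_le k s0 xs))).
rewrite -!expRD ler_expR le_eqVlt; apply/orP; left; apply/eqP.
by field; rewrite s0 gt_eqF.
Qed.

(** With [C] the monomial constant, this choice of [a] makes the Chernoff factor
    [expR (- (C / eps))], and [C] times it is at most [eps / 2] by [double_le_expR] at [C / eps]. A
    positive [a] serves the right tail, a negative one the left tail. *)
Lemma monomial_tangent_bound_tail phi nu k t1 s a eps x : 0 < nu t1 ->
  s != 0 -> 0 <= x * s -> 0 < eps ->
  a ^+ 2 = 2 * monomial_C phi nu k t1 s / eps ->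
  0 <= (x - (tilde_mu phi nu k t1 s + tangent_sigma nu t1 * a)) * a ->
  `|x| ^+ k * tangent_bound phi nu t1 x <=
  eps / 2 * normal_pdf (tilde_mu phi nu k t1 s + tangent_sigma nu t1 * a)
    (tangent_sigma nu t1) x.
Proof.
move=> n0 s0 xs e0 aE xa; apply: (le_trans (monomial_tangent_bound_le _ _ n0 s0 xs)).
have C0 := monomial_C_gt0 phi k s n0; have v0 := tangent_sigma_gt0 n0.
have := normal_pdf_shift v0 xa; rewrite aE.
set C := monomial_C _ _ _ _ _ in C0 * => h.
apply: (le_trans (ler_wpM2l (ltW C0) h)).
rewrite mulrA; apply: ler_wpM2r; first exact: normal_pdf_ge0.
have y0 : 0 < C / eps by rewrite divr_gt0.
have -> : 2 * C / eps / 2 = C / eps by field; lra.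
have := double_le_expR (ltW y0) => e2.
rewrite expRN ler_pdivrMr ?expR_gt0//.
(* This rewriting also hits the [C] in the exponent, which the next line restores. *)
have -> : C = eps / 2 * (2 * (C / eps)) by field; lra.
rewrite [in expR _](_ : eps / 2 * (2 * (C / eps)) = C); last by field; lra.
by rewrite ler_pM2l// divr_gt0.
Qed.

End gaussian_estimates.

(** * Finite maxima and minima, and regularity of the tangent bounds *)

Section envelopes.
Context {R : realType}.
Implicit Types (A : {fset R}) (F : R -> R) (G : R -> R -> R) (c t x : R).

Lemma head_enum_fset A : A != fset0 -> head 0 (enum_fset A) \in A.
Proof.
have mem_head0 (s : seq R) t : t \in s -> head 0 s \in s.
  by case: s => // y s _; rewrite inE eqxx.
by move=> A0; have [t tA] := fset0Pn _ A0; exact: mem_head0 tA.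
Qed.

Lemma le_fset_max A F t : t \in A -> F t <= fset_max A F.
Proof. by move=> tA; exact: le_bigmax_seq. Qed.

Lemma fset_max_le A F c : A != fset0 -> (forall t, t \in A -> F t <= c) ->
  fset_max A F <= c.
Proof.
move=> A0 h; rewrite /fset_max big_seq; apply: bigmax_le => //.
exact/h/head_enum_fset.
Qed.

Lemma fset_min_le A F t : t \in A -> fset_min A F <= F t.
Proof. by move=> tA; exact: ge_bigmin_seq. Qed.

Lemma le_fset_min A F c : A != fset0 -> (forall t, t \in A -> c <= F t) ->
  c <= fset_min A F.
Proof.
move=> A0 h; rewrite /fset_min big_seq; apply: le_bigmin => //.
exact/h/head_enum_fset.
Qed.

Lemma measurable_fset_max A G : (forall t, measurable_fun setT (G t)) ->
  measurable_fun setT (fun x => fset_max A (fun t => G t x)).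
Proof.
(* The starting value depends on the list; making it arbitrary lets the induction pass to the
   tail. *)
move=> mG; rewrite /fset_max; move: (head _ _) => t0.
elim: (enum_fset A) => [|t s IH].
  by under eq_fun do rewrite big_nil; exact: mG.
by under eq_fun do rewrite big_cons; exact: measurable_maxr.
Qed.

Lemma measurable_fset_min A G : (forall t, measurable_fun setT (G t)) ->
  measurable_fun setT (fun x => fset_min A (fun t => G t x)).
Proof.
move=> mG; rewrite /fset_min; move: (head _ _) => t0.
elim: (enum_fset A) => [|t s IH].
  by under eq_fun do rewrite big_nil; exact: mG.
by under eq_fun do rewrite big_cons; exact: measurable_minr.
Qed.

Lemma measurable_tangent_bound (phi curv : R -> R) t :
  measurable_fun setT (tangent_bound phi curv t).
Proof.
by apply: measurable_funM => //; exact: measurable_normal_pdf.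
Qed.

Lemma tangent_bound_gt0 (phi curv : R -> R) t x : 0 < curv t ->
  0 < tangent_bound phi curv t x.
Proof. by move=> c0; rewrite tangent_boundE// expR_gt0. Qed.

(** Continuity is in the tangency point, with [x] fixed: a grid point near [x] then gives nearly the
    same bound at [x] as tangency at [x] itself. *)
Lemma continuous_tangent_bound (phi curv : R -> R) x :
    (forall t, derivable phi t 1) -> continuous (derive1 phi) ->
    continuous curv -> (forall t, 0 < curv t) ->
  continuous (fun t => tangent_bound phi curv t x).
Proof.
move=> dphi cphi' ccurv curv0 t.
under eq_fun do rewrite tangent_boundE//.
have cphi : {for t, continuous phi}.
  by apply: differentiable_continuous; apply/derivable1_diffP.
have cx : (fun t => x - t) @ t --> x - t.
  by apply: cvgB; [exact: cvg_cst|exact: cvg_id].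
apply: continuous_cvg; first exact: continuous_expR.
apply: cvgN; apply: cvgD; first apply: cvgD => //.
  by apply: cvgM => //; exact: cphi'.
apply: cvgM; first by apply: cvgM; [exact: ccurv|exact: cvg_cst].
by apply: cvgM.
Qed.

End envelopes.

(** * Comparison of Lebesgue integrals and mass of scaled normal densities *)

Section integrals.
Context {R : realType}.
Notation mu := (@lebesgue_measure R).
Implicit Types (u v w : R -> R) (D : set R) (m s c : R).

Lemma integrable_le u w : measurable_fun setT u -> (forall x, `|u x| <= w x) ->
  mu.-integrable setT (EFin \o w) -> mu.-integrable setT (EFin \o u).
Proof.
move=> mu_ uw; apply: le_integrable => //; first exact/measurable_EFinP.
by move=> x _ /=; rewrite lee_fin (le_trans (uw x))// ler_norm.
Qed.

Lemma integralB_norm_le u v w : mu.-integrable setT (EFin \o u) ->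
    mu.-integrable setT (EFin \o v) -> mu.-integrable setT (EFin \o w) ->
    (forall x, `|u x - v x| <= w x) ->
  (`|\int[mu]_x (u x)%:E - \int[mu]_x (v x)%:E| <= \int[mu]_x (w x)%:E)%E.
Proof.
move=> iu iv iw uvw; rewrite -integralB_EFin//.
have iuv : mu.-integrable setT (fun x => ((u x)%:E - (v x)%:E)%E).
  exact: integrableB.
have muv := measurable_int _ iuv.
apply: (le_trans (le_abse_integral _ _ muv)) => //.
apply: ge0_le_integral => //.
- exact: measurableT_comp.
- exact: (measurable_int _ iw).
- by move=> x _; rewrite -EFinB lee_fin.
Qed.

Lemma integrable_scaled_normal_pdf c m s :
  mu.-integrable setT (EFin \o (fun x => c * normal_pdf m s x)).
Proof.
have := integrableZl measurableT c (integrable_normal_pdf m s).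
by apply: eq_integrable.
Qed.

Lemma integral_scaled_normal_pdf c m s :
  (\int[mu]_x (c * normal_pdf m s x)%:E = c%:E)%E.
Proof.
under eq_integral do rewrite EFinM.
by rewrite integralZl ?integral_normal_pdf ?mule1//; exact: integrable_normal_pdf.
Qed.

(** The majorant dominates on [D] only but is integrated over the whole line, where the mass of a
    normal density is known. *)
Lemma ge0_integral_le_restrict u w D : measurable D -> measurable_fun setT u ->
    (forall x, 0 <= u x) -> (forall x, 0 <= w x) ->
    mu.-integrable setT (EFin \o w) -> (forall x, D x -> u x <= w x) ->
  (\int[mu]_(x in D) (u x)%:E <= \int[mu]_x (w x)%:E)%E.
Proof.
move=> mD mu_ u0 w0 iw uw; have mw := measurable_int _ iw.
apply: (@le_trans _ _ (\int[mu]_(x in D) (w x)%:E)%E); last first.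
  by apply: ge0_subset_integral => // x _; rewrite lee_fin.
apply: ge0_le_integral => //.
- by move=> x _; rewrite lee_fin.
- by apply/measurable_EFinP; exact: measurable_funS mu_.
- exact: measurable_funS mw.
Qed.

End integrals.

(** * Envelopes against powers: integrability and tails *)

Section monomial_integrals.
Context {R : realType} (phi beta nu : R -> R).
Hypothesis beta_gt0 : forall t, 0 < beta t.
Hypothesis nu_gt0 : forall t, 0 < nu t.
Hypothesis phi_bounds : forall t x,
  phi t + derive1 phi t * (x - t) + nu t / 2 * (x - t) ^+ 2 <= phi x /\
  phi x <= phi t + derive1 phi t * (x - t) + beta t / 2 * (x - t) ^+ 2.
Variables (k : nat) (t1 : R).
Notation mu := (@lebesgue_measure R).
Notation f := (fun x : R => x ^+ k).
Notation sigma := (tangent_sigma nu t1).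
Notation tmu := (tilde_mu phi nu k t1).
Notation tC := (monomial_C phi nu k t1).
Notation Up := (upper_envelope phi nu).
Notation Lo := (lower_envelope phi beta).
Notation gapT := (gap phi beta nu).
Implicit Types (A : {fset R}) (t x s a eps : R).

Lemma tangent_bound_target t x :
  tangent_bound phi beta t x <= target phi x <= tangent_bound phi nu t x.
Proof.
have [lo up] := phi_bounds t x.
by rewrite !tangent_boundE// /target !ler_expR !lerN2 lo up.
Qed.

Lemma envelope_target A x : A != fset0 -> Lo A x <= target phi x <= Up A x.
Proof.
move=> A0; rewrite fset_max_le ?le_fset_min// => t _;
  by have /andP[] := tangent_bound_target t x.
Qed.

Lemma lower_envelope_ge0 A x : A != fset0 -> 0 <= Lo A x.
Proof.
move=> A0; have [t tA] := fset0Pn _ A0.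
apply: le_trans (le_fset_max _ tA); exact/ltW/tangent_bound_gt0.
Qed.

Lemma gap_ge0 A x : A != fset0 -> 0 <= gapT A x.
Proof.
move=> A0; have /andP[lo up] := envelope_target x A0.
by rewrite subr_ge0 (le_trans lo up).
Qed.

Lemma gap_le_tangent_bounds A t x : t \in A ->
  gapT A x <= tangent_bound phi nu t x - tangent_bound phi beta t x.
Proof.
move=> tA; apply: lerB.
  exact: (fset_min_le (fun t => tangent_bound phi nu t x) tA).
exact: (le_fset_max (fun t => tangent_bound phi beta t x) tA).
Qed.

Lemma measurable_upper_envelope A : measurable_fun setT (Up A).
Proof.
by apply: measurable_fset_min => t; exact: measurable_tangent_bound.
Qed.

Lemma measurable_lower_envelope A : measurable_fun setT (Lo A).
Proof.
by apply: measurable_fset_max => t; exact: measurable_tangent_bound.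
Qed.

Lemma measurable_gap A : measurable_fun setT (gapT A).
Proof.
apply: measurable_funB; first exact: measurable_upper_envelope.
exact: measurable_lower_envelope.
Qed.

Lemma measurable_exprn_norm : measurable_fun setT (fun x : R => `|x| ^+ k).
Proof. by apply: measurable_funX; exact: normr_measurable. Qed.

Lemma measurable_funrpos_exprn : measurable_fun setT (funrpos f).
Proof. by apply: measurable_funrpos; exact: exprn_measurable. Qed.

Lemma measurable_funrneg_exprn : measurable_fun setT (funrneg f).
Proof. by apply: measurable_funrneg; exact: exprn_measurable. Qed.

Lemma funrposDneg_exprn x : funrpos f x + funrneg f x = `|x| ^+ k.
Proof. by have /(congr1 (@^~ x)) := funrposDneg f; rewrite -normrX. Qed.

Lemma funrposBneg_exprn x : funrpos f x - funrneg f x = x ^+ k.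
Proof. by have /(congr1 (@^~ x)) := funrposBneg f. Qed.

Lemma funrpos_exprn_le x : funrpos f x <= `|x| ^+ k.
Proof. by rewrite -funrposDneg_exprn lerDl. Qed.

Lemma funrneg_exprn_le x : funrneg f x <= `|x| ^+ k.
Proof. by rewrite -funrposDneg_exprn lerDr. Qed.

(** The Gaussian majorants for [s = 1] and [s = -1] cover the two half lines, and their sum
    dominates everywhere. *)
Lemma integrable_exprn_tangent_bound :
  mu.-integrable setT (EFin \o (fun x => `|x| ^+ k * tangent_bound phi nu t1 x)).
Proof.
pose g s x := tC s * normal_pdf (tmu s) sigma x.
have g0 s x : 0 <= g s x.
  by rewrite mulr_ge0 ?normal_pdf_ge0// ltW// monomial_C_gt0.
apply: (@integrable_le _ _ (g 1 \+ g (-1))).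
- apply: measurable_funM; first exact: measurable_exprn_norm.
  exact: measurable_tangent_bound.
- move=> x; rewrite ger0_norm; last first.
    by rewrite mulr_ge0 ?exprn_ge0// ltW// tangent_bound_gt0.
  have [x0|x0] := leP 0 x.
    apply: (@le_trans _ _ (g 1 x)); last by rewrite /= lerDl.
    by apply: monomial_tangent_bound_le; rewrite ?mulr1// oner_neq0.
  apply: (@le_trans _ _ (g (-1) x)); last by rewrite /= lerDr.
  by apply: monomial_tangent_bound_le; rewrite // mulrN1 oppr_ge0 ltW.
- have := integrableD measurableT (integrable_scaled_normal_pdf (tC 1) (tmu 1) sigma)
    (integrable_scaled_normal_pdf (tC (-1)) (tmu (-1)) sigma).
  by apply: eq_integrable.
Qed.

(** A single majorant for all grids containing [t1]: [g] will be a part of the power or its absolute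
    value, [h] an envelope or the gap. *)
Lemma integrable_le_exprn_tangent_bound (g h : R -> R) :
    measurable_fun setT g -> measurable_fun setT h ->
    (forall x, 0 <= g x <= `|x| ^+ k) ->
    (forall x, 0 <= h x <= tangent_bound phi nu t1 x) ->
  mu.-integrable setT (EFin \o (fun x => g x * h x)).
Proof.
move=> mg mh gx hx; apply: integrable_le integrable_exprn_tangent_bound.
  exact: measurable_funM.
move=> x; have /andP[g0 gk] := gx x; have /andP[h0 hb] := hx x.
by rewrite ger0_norm ?mulr_ge0// ler_pM.
Qed.

Lemma funrpos_exprn_bounds x : 0 <= funrpos f x <= `|x| ^+ k.
Proof. by rewrite funrpos_ge0 funrpos_exprn_le. Qed.

Lemma funrneg_exprn_bounds x : 0 <= funrneg f x <= `|x| ^+ k.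
Proof. by rewrite funrneg_ge0 funrneg_exprn_le. Qed.

(** * Integral bounds and tails for one grid containing [t1] *)

Section fixed_grid.
Variable A : {fset R}.
Hypothesis t1A : t1 \in A.

Lemma grid_neq0 : A != fset0.
Proof. by apply/fset0Pn; exists t1. Qed.

Lemma lower_envelope_bounds x : 0 <= Lo A x <= tangent_bound phi nu t1 x.
Proof.
rewrite lower_envelope_ge0 ?grid_neq0//=.
have /andP[lo _] := envelope_target x grid_neq0.
by have /andP[_ up] := tangent_bound_target t1 x; exact: le_trans lo up.
Qed.

Lemma upper_envelope_bounds x : 0 <= Up A x <= tangent_bound phi nu t1 x.
Proof.
have /andP[lo up] := envelope_target x grid_neq0.
rewrite [Up A x <= _]fset_min_le// andbT (le_trans _ up)// (le_trans _ lo)//.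
exact: lower_envelope_ge0 grid_neq0.
Qed.

Lemma gap_bounds x : 0 <= gapT A x <= tangent_bound phi nu t1 x.
Proof.
rewrite gap_ge0 ?grid_neq0//=; have /andP[lo _] := lower_envelope_bounds x.
have /andP[_ up] := upper_envelope_bounds x.
by rewrite lerBlDr (le_trans up)// lerDl.
Qed.

(** The letters [p] and [n] refer to the positive and negative parts of the power, [U] and [L] to
    the envelopes. Integrability of the four products lets differences of extended real integrals be
    merged into one integral. *)
Let pU := integrable_le_exprn_tangent_bound measurable_funrpos_exprn
  (measurable_upper_envelope A) funrpos_exprn_bounds upper_envelope_bounds.
Let pL := integrable_le_exprn_tangent_bound measurable_funrpos_exprn
  (measurable_lower_envelope A) funrpos_exprn_bounds lower_envelope_bounds.
Let nU := integrable_le_exprn_tangent_bound measurable_funrneg_exprn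
  (measurable_upper_envelope A) funrneg_exprn_bounds upper_envelope_bounds.
Let nL := integrable_le_exprn_tangent_bound measurable_funrneg_exprn
  (measurable_lower_envelope A) funrneg_exprn_bounds lower_envelope_bounds.

Let u x := funrpos f x * Up A x - funrneg f x * Lo A x.
Let l x := funrpos f x * Lo A x - funrneg f x * Up A x.

Let iu : mu.-integrable setT (EFin \o u).
Proof. by have := integrableB measurableT pU nL; apply: eq_integrable. Qed.

Let il : mu.-integrable setT (EFin \o l).
Proof. by have := integrableB measurableT pL nU; apply: eq_integrable. Qed.

Lemma integrable_exprn_gap :
  mu.-integrable setT (EFin \o (fun x => `|x| ^+ k * gapT A x)).
Proof.
apply: integrable_le_exprn_tangent_bound.
- exact: measurable_exprn_norm.
- exact: measurable_gap.
- by move=> x; rewrite exprn_ge0//=.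
- exact: gap_bounds.
Qed.

Let upper_integralE : upper_integral phi beta nu f A = (\int[mu]_x (u x)%:E)%E.
Proof. exact/esym/(integralB_EFin measurableT pU nL). Qed.

Let lower_integralE : lower_integral phi beta nu f A = (\int[mu]_x (l x)%:E)%E.
Proof. exact/esym/(integralB_EFin measurableT pL nU). Qed.

(** Pointwise, [u - l] factors as the sum of the two parts of the power times the difference of the
    envelopes. *)
Lemma integral_gapE : integral_gap phi beta nu f A =
  (\int[mu]_x (`|x| ^+ k * gapT A x)%:E)%E.
Proof.
rewrite /integral_gap upper_integralE lower_integralE -(integralB_EFin measurableT iu il).
apply: eq_integral => x _; rewrite -EFinB -funrposDneg_exprn /u /l /gap.
by congr (_%:E); ring.
Qed.

Hypothesis I_finite : mu.-integrable setT (fun x => (x ^+ k * target phi x)%:E).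

(** The first difference is [p * (U - P) + n * (P - L)], the second is minus
    [p * (P - L) + n * (U - P)]; each factor in parentheses lies between [0] and [U - L]. *)
Let funrpos_sum (p n L P U : R) : 0 <= p -> 0 <= n -> L <= P <= U ->
  `|(p * U - n * L) - (p - n) * P| <= (p + n) * (U - L) /\
  `|(p * L - n * U) - (p - n) * P| <= (p + n) * (U - L).
Proof.
move=> p0 n0 /andP[LP PU].
have h a b c : 0 <= a -> b <= c -> a * b <= a * c by move=> *; exact: ler_wpM2l.
(* The products are supplied as facts, after which the claim is linear in them. *)
have := (h _ _ _ p0 LP, h _ _ _ p0 PU, h _ _ _ n0 LP, h _ _ _ n0 PU).
by move=> [[[? ?] ?] ?]; split; rewrite ler_norml; apply/andP; split; lra.
Qed.

Lemma upper_integral_dist :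
  (`|upper_integral phi beta nu f A - target_integral phi f| <=
   \int[mu]_x (`|x| ^+ k * gapT A x)%:E)%E.
Proof.
rewrite upper_integralE; apply: integralB_norm_le => //.
  exact: integrable_exprn_gap.
move=> x; rewrite -funrposDneg_exprn -[in X in X * target _ _]funrposBneg_exprn.
by have [] := funrpos_sum (funrpos_ge0 f x) (funrneg_ge0 f x) (envelope_target x grid_neq0).
Qed.

Lemma lower_integral_dist :
  (`|lower_integral phi beta nu f A - target_integral phi f| <=
   \int[mu]_x (`|x| ^+ k * gapT A x)%:E)%E.
Proof.
rewrite lower_integralE; apply: integralB_norm_le => //.
  exact: integrable_exprn_gap.
move=> x; rewrite -funrposDneg_exprn -[in X in X * target _ _]funrposBneg_exprn.
by have [] := funrpos_sum (funrpos_ge0 f x) (funrneg_ge0 f x) (envelope_target x grid_neq0).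
Qed.

Lemma exprn_gap_tail s a eps x : s != 0 -> 0 <= x * s -> 0 < eps ->
  a ^+ 2 = 2 * tC s / eps -> 0 <= (x - (tmu s + sigma * a)) * a ->
  `|x| ^+ k * gapT A x <= eps / 2 * normal_pdf (tmu s + sigma * a) sigma x.
Proof.
move=> s0 xs e0 aE xa; have /andP[_ gb] := gap_bounds x.
apply: le_trans (monomial_tangent_bound_tail (nu_gt0 t1) s0 xs e0 aE xa).
by apply: ler_wpM2l gb; rewrite exprn_ge0.
Qed.

(** The value [eps / 2] is the mass of the dominating scaled density. The alternative [g x = 0]
    disposes of the half line on which a part of the power vanishes. *)
Lemma integral_gap_tail (D : set R) (g : R -> R) s a eps :
    measurable D -> measurable_fun setT g ->
    (forall x, 0 <= g x <= `|x| ^+ k) -> s != 0 -> 0 < eps ->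
    a ^+ 2 = 2 * tC s / eps ->
    (forall x, D x -> g x = 0 \/
       0 <= x * s /\ 0 <= (x - (tmu s + sigma * a)) * a) ->
  (\int[mu]_(x in D) (g x * gapT A x)%:E <= (eps / 2)%:E)%E.
Proof.
move=> mD mg gk s0 e0 aE tail.
rewrite -(integral_scaled_normal_pdf (eps / 2) (tmu s + sigma * a) sigma).
apply: ge0_integral_le_restrict => //.
- by apply: measurable_funM => //; exact: measurable_gap.
- move=> x; have /andP[g0 _] := gk x; rewrite mulr_ge0//.
  by rewrite gap_ge0// grid_neq0.
- by move=> x; rewrite mulr_ge0 ?normal_pdf_ge0// divr_ge0// ltW.
- exact: integrable_scaled_normal_pdf.
- move=> x /tail[->|[xs xa]].
    by rewrite mul0r mulr_ge0 ?normal_pdf_ge0// divr_ge0// ltW.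
  apply: le_trans (exprn_gap_tail s0 xs e0 aE xa).
  have /andP[_ gx] := gk x; apply: ler_wpM2r => //.
  by rewrite gap_ge0// grid_neq0.
Qed.

End fixed_grid.
End monomial_integrals.

(** * Limits of extended real sequences from eventual bounds *)

Section ereal_limits.
Context {R : realType}.
Implicit Types (u : nat -> \bar R) (l : \bar R) (delta : R).

Lemma cvge_near_le u delta : u n @[n --> \oo] --> 0%E -> 0 < delta ->
  \forall n \near \oo, (u n <= delta%:E)%E.
Proof.
move=> /fine_cvgP[fu /cvgrPdist_lt cu] d0.
near=> n; have un : u n \is a fin_num by near: n.
have : `|0 - fine (u n)| < delta by near: n; exact: cu.
rewrite -[u n]fineK// lee_fin sub0r normrN => /ltW; exact/le_trans/ler_norm.
Unshelve. all: by end_near. Qed.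

Lemma near_dist_le_cvge u l : l \is a fin_num ->
    (forall delta, 0 < delta -> \forall n \near \oo, (`|u n - l| <= delta%:E)%E) ->
  u n @[n --> \oo] --> l.
Proof.
case: l => // r _ ul.
have fin n delta : (`|u n - r%:E| <= delta%:E)%E -> u n \is a fin_num.
  by case: (u n).
apply: cvg_EFin.
  (* Being within distance 1 of a real number forces [u n] to be finite. *)
  by near=> n; apply: (@fin n 1); near: n; exact: ul.
apply/cvgrPdist_lt => e e0; near=> n.
(* Halving [e] turns the non-strict bound into a strict one. *)
have h : (`|u n - r%:E| <= (e / 2)%:E)%E by near: n; apply: ul; rewrite divr_gt0.
have := h; rewrite /= -[u n]fineK ?(fin _ _ h)// -EFinB abse_EFin lee_fin distrC.
by move=> /le_lt_trans; apply; lra.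
Unshelve. all: by end_near. Qed.

End ereal_limits.

(** * Dispersion of a grid in a bounded set *)

Section dispersion.
Context {R : realType}.
Implicit Types (A : {fset R}) (K : set R) (T : nat -> {fset R}) (d M x t : R).

Lemma dispersion_lt A K d M x : A != fset0 -> (forall y, K y -> `|y| <= M) ->
  dispersion A K < d -> K x -> exists2 t, t \in A & `|x - t| < d.
Proof.
move=> A0 KM dAK Kx; have [t0 t0A] := fset0Pn _ A0.
have lb y : has_lbound [set `|y - t| | t in [set` A]].
  by exists 0 => _ [t _ <-].
(* The distance to one fixed grid point bounds all the infima, as [K] is bounded; [sup] is then a
   true supremum and not its default value. *)
have ub : has_ubound [set inf [set `|y - t| | t in [set` A]] | y in K].
  exists (M + `|t0|) => _ [y Ky <-].
  apply: (@le_trans _ _ `|y - t0|); first by apply: ge_inf => //; exists t0.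
  by rewrite (le_trans (ler_normB _ _))// lerD2r KM.
have : inf [set `|x - t| | t in [set` A]] < d.
  by apply: le_lt_trans dAK; apply: ub_le_sup => //; exists x.
by case/inf_lt => [|_ [t tA <-] xt]; [exists `|x - t0|, t0|exists t].
Qed.

(** This makes the tangent bound at [t1] a dominating function independent of [n]. *)
Lemma nested_grids_mem t1 T n : nested_grids t1 T -> (0 < n)%N -> t1 \in T n.
Proof.
case=> T1 _ Tn; case: n => // n _; elim: n => [|n IH]; first by rewrite T1 inE.
by apply: (fsubsetP (Tn n.+1 _)).
Qed.

End dispersion.

(** * Vanishing of the gap on bounded sets filled by the grids *)

Section filling_grids.
Context {R : realType} (phi beta nu : R -> R).
Hypothesis phi_derivable : forall x, derivable phi x 1.
Hypothesis phi'_continuous : continuous (derive1 phi).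
Hypothesis beta_continuous : continuous beta.
Hypothesis nu_continuous : continuous nu.
Hypothesis beta_gt0 : forall t, 0 < beta t.
Hypothesis nu_gt0 : forall t, 0 < nu t.
Hypothesis phi_bounds : forall t x,
  phi t + derive1 phi t * (x - t) + nu t / 2 * (x - t) ^+ 2 <= phi x /\
  phi x <= phi t + derive1 phi t * (x - t) + beta t / 2 * (x - t) ^+ 2.
Variables (k : nat) (t1 s0 s1 : R).
Hypothesis s0_gt0 : 0 < s0.
Hypothesis s1_lt0 : s1 < 0.
Notation mu := (@lebesgue_measure R).
Notation sigma := (tangent_sigma nu t1).
Notation tmu := (tilde_mu phi nu k t1).
Notation tC := (monomial_C phi nu k t1).
Notation gapT := (gap phi beta nu).
Implicit Types (A : {fset R}) (T : nat -> {fset R}) (K : set R).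

Lemma gap_cvg0 T K M x : nested_grids t1 T -> (forall y, K y -> `|y| <= M) ->
    dispersion (T n) K @[n --> \oo] --> (0 : R) -> K x ->
  gapT (T n) x @[n --> \oo] --> (0 : R).
Proof.
move=> nT KM /cvgrPdist_lt dK Kx; have [_ T0 _] := nT.
pose D t := tangent_bound phi nu t x - tangent_bound phi beta t x.
have : D t @[t --> x] --> (0 : R).
  (* At [t = x] both tangent bounds take the value of the target. *)
  have <- : D x = 0.
    by rewrite /D !tangent_boundE// !subrr expr0n/= !mulr0 subrr.
  apply: cvgB.
    exact: (continuous_tangent_bound phi_derivable phi'_continuous nu_continuous nu_gt0).
  exact: (continuous_tangent_bound phi_derivable phi'_continuous beta_continuous beta_gt0).
move=> /cvgrPdist_lt cD; apply/cvgrPdist_lt => e e0.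
have /nbhs_ballP[d /= d0 dD] := cD _ e0.
near=> n; have n0 : (0 < n)%N by near: n; exact: nbhs_infty_gt.
have : `|0 - dispersion (T n) K| < d by near: n; exact: dK.
rewrite sub0r normrN => /(le_lt_trans (ler_norm _)) Tnd.
have [t tT xt] := dispersion_lt (T0 _ n0) KM Tnd Kx.
rewrite sub0r normrN ger0_norm ?(gap_ge0 beta_gt0 nu_gt0 phi_bounds _ (T0 _ n0))//.
apply: (le_lt_trans (gap_le_tangent_bounds _ _ _ _ tT)).
have := dD t xt; rewrite /= sub0r normrN; exact/le_lt_trans/ler_norm.
Unshelve. all: by end_near. Qed.

Lemma integral_gap_cvg0 T K M : nested_grids t1 T -> measurable K ->
    (forall y, K y -> `|y| <= M) ->
    dispersion (T n) K @[n --> \oo] --> (0 : R) ->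
  (\int[mu]_(x in K) (`|x| ^+ k * gapT (T n) x)%:E)%E @[n --> \oo] --> 0%E.
Proof.
(* The index is shifted because domination must hold for every term, while [T 0] is arbitrary. *)
move=> nT mK KM dK; rewrite -(cvg_shiftS _ (nbhs 0%E)).
rewrite -(integral0 mu K).
have iw := integrable_exprn_tangent_bound phi nu_gt0 k t1.
apply: (@dominated_cvg _ _ _ mu K mK _ _
  (EFin \o (fun x => `|x| ^+ k * tangent_bound phi nu t1 x))) => //.
- move=> n; apply/measurable_EFinP; apply: measurable_funTS.
  by apply: measurable_funM; [exact: measurable_exprn_norm|exact: measurable_gap].
- move=> x Kx; apply: cvg_EFin; first by near=> n.
  rewrite -(mulr0 (`|x| ^+ k)); apply: cvgMr.
  have := gap_cvg0 nT KM dK Kx.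
  by rewrite -(cvg_shiftS _ (nbhs (0 : R))).
- exact: integrableS iw.
- move=> n x Kx; rewrite /= lee_fin.
  have t1T := nested_grids_mem nT (ltn0Sn n).
  have /andP[g0 gb] := gap_bounds beta_gt0 nu_gt0 phi_bounds t1T x.
  by rewrite ger0_norm ?mulr_ge0 ?exprn_ge0//; apply: ler_wpM2l => //; exact: exprn_ge0.
Unshelve. all: by end_near. Qed.

(** * The compact sets attached to one [eps] and the integrals outside them *)

Section fixed_eps.
Variable eps : R.
Hypothesis eps_gt0 : 0 < eps.
Notation Kp := (Kplus phi nu k t1 eps s0).
Notation Km := (Kminus phi nu k t1 eps s1).
Notation K := (Kset phi nu k t1 eps s0 s1).
(** The cutoffs are signed: the negative [a1] sends the left tail through the same Chernoff bound as
    the right one. *)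
Notation a0 := (Num.sqrt (2 * tC s0 / eps)).
Notation a1 := (- Num.sqrt (2 * tC s1 / eps)).

Lemma cutoff_sqr s : Num.sqrt (2 * tC s / eps) ^+ 2 = 2 * tC s / eps.
Proof.
rewrite sqr_sqrtr// divr_ge0//; last exact: ltW.
by rewrite mulr_ge0// ltW// monomial_C_gt0.
Qed.

Lemma notin_Kplus x : 0 <= x -> (~` Kp) x ->
  0 <= (x - (tmu s0 + sigma * a0)) * a0.
Proof.
move=> x0; rewrite /Kplus /= tilde_CE// in_itv/= x0/= => /negP.
rewrite -ltNge gt_max => /andP[_ xK].
by rewrite mulr_ge0 ?sqrtr_ge0// subr_ge0 ltW.
Qed.

Lemma notin_Kminus x : x <= 0 -> (~` Km) x ->
  0 <= (x - (tmu s1 + sigma * a1)) * a1.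
Proof.
move=> x0; rewrite /Kminus /= hat_CE// in_itv/= x0 andbT => /negP.
rewrite -ltNge lt_min => /andP[_ xK].
by rewrite mulrN -mulNr mulr_ge0 ?sqrtr_ge0// oppr_ge0 subr_le0 mulrN ltW.
Qed.

Lemma measurable_Kplus : measurable Kp. Proof. exact: measurable_itv. Qed.

Lemma measurable_Kminus : measurable Km. Proof. exact: measurable_itv. Qed.

Lemma measurable_Kset : measurable K.
Proof. by apply: measurableU; [exact: measurable_Kminus|exact: measurable_Kplus]. Qed.

Lemma Kset_bounded : exists M, forall y, K y -> `|y| <= M.
Proof.
rewrite /Kset /Kminus /Kplus; set b := Num.min _ _; set c := Num.max _ _.
have b0 : b <= 0 by rewrite ge_min lexx.
have c0 : 0 <= c by rewrite le_max lexx.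
(* Since [b <= 0 <= c], the length [c - b] bounds both endpoints in absolute value. *)
exists (c - b) => y [|] /=; rewrite in_itv/= => /andP[? ?];
  by rewrite ler_norml; apply/andP; split; lra.
Qed.

Section fixed_grid.
Variable A : {fset R}.
Hypothesis t1A : t1 \in A.

(** An odd power has no positive part on the negative half line, so only the right tail counts. *)
Lemma integral_funrpos_gap_Kplus : odd k ->
  (\int[mu]_(x in ~` Kp) (funrpos (fun x => x ^+ k) x * gapT A x)%:E
   <= (eps / 2)%:E)%E.
Proof.
move=> oddk; apply: (@integral_gap_tail _ _ _ _ beta_gt0 nu_gt0 phi_bounds
  k _ _ t1A _ _ s0 a0) => //.
- by apply: measurableC; exact: measurable_Kplus.
- exact: measurable_funrpos_exprn.
- exact: funrpos_exprn_bounds.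
- by rewrite gt_eqF.
- exact: cutoff_sqr.
- move=> x Kx; have [x0|x0] := leP 0 x; [right|left].
    by rewrite mulr_ge0 ?notin_Kplus// ltW.
  by apply/max_idPr; rewrite exprn_odd_le0// ltW.
Qed.

(** The positive part of an even power lives on both half lines; this bound and the next one cut
    each half line by its own compact set. *)
Lemma integral_funrpos_gap_nneg :
  (\int[mu]_(x in `[0%R, +oo[ `\` Kp)
     (funrpos (fun x => x ^+ k) x * gapT A x)%:E <= (eps / 2)%:E)%E.
Proof.
apply: (@integral_gap_tail _ _ _ _ beta_gt0 nu_gt0 phi_bounds
  k _ _ t1A _ _ s0 a0) => //.
- by apply: measurableD => //; exact: measurable_Kplus.
- exact: measurable_funrpos_exprn.
- exact: funrpos_exprn_bounds.
- by rewrite gt_eqF.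
- exact: cutoff_sqr.
- move=> x [] /=; rewrite in_itv/= andbT => x0 Kx; right.
  by rewrite mulr_ge0 ?notin_Kplus// ltW.
Qed.

Lemma integral_funrpos_gap_npos :
  (\int[mu]_(x in `]-oo, 0%R] `\` Km)
     (funrpos (fun x => x ^+ k) x * gapT A x)%:E <= (eps / 2)%:E)%E.
Proof.
apply: (@integral_gap_tail _ _ _ _ beta_gt0 nu_gt0 phi_bounds
  k _ _ t1A _ _ s1 a1) => //.
- by apply: measurableD => //; exact: measurable_Kminus.
- exact: measurable_funrpos_exprn.
- exact: funrpos_exprn_bounds.
- by rewrite lt_eqF.
- by rewrite sqrrN cutoff_sqr.
- move=> x [] /=; rewrite in_itv/= => x0 Kx; right.
  by rewrite mulr_le0 ?notin_Kminus// ltW.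
Qed.

(** The negative part of any power vanishes on positive numbers, which leaves the left tail. *)
Lemma integral_funrneg_gap_Kminus :
  (\int[mu]_(x in ~` Km) (funrneg (fun x => x ^+ k) x * gapT A x)%:E
   <= (eps / 2)%:E)%E.
Proof.
apply: (@integral_gap_tail _ _ _ _ beta_gt0 nu_gt0 phi_bounds
  k _ _ t1A _ _ s1 a1) => //.
- by apply: measurableC; exact: measurable_Kminus.
- exact: measurable_funrneg_exprn.
- exact: funrneg_exprn_bounds.
- by rewrite lt_eqF.
- by rewrite sqrrN cutoff_sqr.
- move=> x Kx; have [x0|x0] := leP x 0; [right|left].
    by rewrite mulr_le0 ?notin_Kminus// ltW.
  by apply/max_idPr; rewrite oppr_le0 exprn_ge0// ltW.
Qed.

Lemma integral_gap_outside_Kset :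
  (\int[mu]_(x in ~` K) (`|x| ^+ k * gapT A x)%:E <= eps%:E)%E.
Proof.
pose g s a x := eps / 2 * normal_pdf (tmu s + sigma * a) sigma x.
have g0 s a x : 0 <= g s a x by rewrite mulr_ge0 ?normal_pdf_ge0// divr_ge0// ltW.
have ig s a : mu.-integrable setT (EFin \o g s a).
  exact: integrable_scaled_normal_pdf.
(* The allowance [eps] is the total mass of two tail majorants, [eps / 2] for each half line. *)
have <- : (\int[mu]_x ((g s0 a0 \+ g s1 a1) x)%:E = eps%:E)%E.
  under eq_integral do rewrite EFinD.
  by rewrite integralD_EFin// !integral_scaled_normal_pdf -EFinD -splitr.
apply: ge0_integral_le_restrict.
- by apply: measurableC; exact: measurable_Kset.
- by apply: measurable_funM; [exact: measurable_exprn_norm|exact: measurable_gap].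
- move=> x; rewrite mulr_ge0 ?exprn_ge0//.
  by have /andP[] := gap_bounds beta_gt0 nu_gt0 phi_bounds t1A x.
- by move=> x; rewrite addr_ge0.
- by have := integrableD measurableT (ig s0 a0) (ig s1 a1); apply: eq_integrable.
- move=> x; rewrite /Kset setCU => -[Kmx Kpx]; have [x0|x0] := leP 0 x.
    apply: (@le_trans _ _ (g s0 a0 x)); last by rewrite lerDl.
    apply: (exprn_gap_tail beta_gt0 nu_gt0 phi_bounds t1A) => //.
    + by rewrite gt_eqF.
    + by rewrite mulr_ge0// ltW.
    + exact: cutoff_sqr.
    + exact: notin_Kplus.
  apply: (@le_trans _ _ (g s1 a1 x)); last by rewrite lerDr.
  apply: (exprn_gap_tail beta_gt0 nu_gt0 phi_bounds t1A) => //.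
  + by rewrite lt_eqF.
  + by rewrite mulr_le0// ltW.
  + by rewrite sqrrN cutoff_sqr.
  + by apply: notin_Kminus => //; exact: ltW.
Qed.

Lemma integral_gap_split :
  (\int[mu]_x (`|x| ^+ k * gapT A x)%:E <=
   eps%:E + \int[mu]_(x in K) (`|x| ^+ k * gapT A x)%:E)%E.
Proof.
rewrite -(setUv K) ge0_integral_setU//.
- by rewrite addeC leeD2r// integral_gap_outside_Kset.
- exact: measurable_Kset.
- by apply: measurableC; exact: measurable_Kset.
- rewrite setUv; apply/measurable_EFinP.
  by apply: measurable_funM; [exact: measurable_exprn_norm|exact: measurable_gap].
- move=> x _; rewrite lee_fin mulr_ge0 ?exprn_ge0//.
  by have /andP[] := gap_bounds beta_gt0 nu_gt0 phi_bounds t1A x.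
- exact/disj_set2P/setICr.
Qed.

End fixed_grid.

(** The part outside [K] costs [eps] for every grid; the part inside is eventually below any
    [delta]. *)
Lemma near_integral_gap_le T delta : nested_grids t1 T ->
    dispersion (T n) K @[n --> \oo] --> (0 : R) -> 0 < delta ->
  \forall n \near \oo,
    (\int[mu]_x (`|x| ^+ k * gapT (T n) x)%:E <= (eps + delta)%:E)%E.
Proof.
move=> nT dK d0; have [M KM] := Kset_bounded.
have cK := integral_gap_cvg0 nT measurable_Kset KM dK.
near=> n; have n0 : (0 < n)%N by near: n; exact: nbhs_infty_gt.
apply: (le_trans (integral_gap_split (nested_grids_mem nT n0))).
by rewrite EFinD leeD2l//; near: n; exact: cvge_near_le.
Unshelve. all: by end_near. Qed.

End fixed_eps.
End filling_grids.

(** * Tail bounds, the eventual bound on the gap, and two forms of the limits *)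

Theorem theorem1 (R : realType) (phi beta nu : R -> R)
  (phi_derivable : forall x : R, derivable phi x 1)
  (phi'_continuous : continuous (derive1 phi))
  (beta_continuous : continuous beta) (nu_continuous : continuous nu)
  (beta_gt0 : forall t : R, 0 < beta t) (nu_gt0 : forall t : R, 0 < nu t)
  (phi_bounds : forall t x : R,
     phi t + derive1 phi t * (x - t) + nu t / 2 * (x - t) ^+ 2 <= phi x /\
     phi x <= phi t + derive1 phi t * (x - t) + beta t / 2 * (x - t) ^+ 2)
  (k : nat) (f : R -> R) (f_def : forall x : R, f x = x ^+ k)
  (I_finite : (@lebesgue_measure R).-integrable [set: R]
                (fun x : R => (f x * target phi x)%:E))
  (s0 s1 t1 : R) (s0_gt0 : 0 < s0) (s1_lt0 : s1 < 0) :
  (* for a fixed eps: tail bounds, then the bound on the gap *)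
  (forall (eps : R) (T : nat -> {fset R}), 0 < eps ->
     grids_filling (Kset phi nu k t1 eps s0 s1) t1 T ->
     (forall n : nat, (0 < n)%N ->
        [/\ odd k ->
              (\int[lebesgue_measure]_(x in ~` Kplus phi nu k t1 eps s0)
                 (funrpos f x * gap phi beta nu (T n) x)%:E
               <= (eps / 2)%:E)%E,
            ~~ odd k ->
              (\int[lebesgue_measure]_(x in
                   `[0%R, +oo[ `\` Kplus phi nu k t1 eps s0)
                 (funrpos f x * gap phi beta nu (T n) x)%:E
               <= (eps / 2)%:E)%E /\
              (\int[lebesgue_measure]_(x in
                   `]-oo, 0%R] `\` Kminus phi nu k t1 eps s1)
                 (funrpos f x * gap phi beta nu (T n) x)%:E
               <= (eps / 2)%:E)%E &
            (\int[lebesgue_measure]_(x in ~` Kminus phi nu k t1 eps s1)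
               (funrneg f x * gap phi beta nu (T n) x)%:E
             <= (eps / 2)%:E)%E]) /\
     (exists n0 : nat, (0 < n0)%N /\ forall n : nat, (n0 <= n)%N ->
        (`| integral_gap phi beta nu f (T n) | <=
         (eps * (1 + tilde_mu phi nu k t1 s0 + `| hat_mu phi nu k t1 s1 |
                 + Num.sqrt (2 * hat_sigma nu t1 s1 ^+ 2
                               * hat_C phi nu k t1 s1 / eps)
                 + Num.sqrt (2 * tilde_sigma nu t1 s0 ^+ 2
                               * tilde_C phi nu k t1 s0 / eps)))%:E)%E))
  (* limits, when the grids are chosen in terms of eps and eps tends to 0 *)
  /\ (forall delta : R, 0 < delta ->
      \forall eps \near (0 : R)^'+, forall T : nat -> {fset R},
        grids_filling (Kset phi nu k t1 eps s0 s1) t1 T ->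
        \forall n \near \oo,
          [/\ (`| integral_gap phi beta nu f (T n) | <= delta%:E)%E,
              (`| upper_integral phi beta nu f (T n)
                  - target_integral phi f | <= delta%:E)%E &
              (`| lower_integral phi beta nu f (T n)
                  - target_integral phi f | <= delta%:E)%E])
  (* limits along one sequence of grids, filling the compact sets of every eps *)
  /\ (forall T : nat -> {fset R}, nested_grids t1 T ->
      (forall eps : R, 0 < eps ->
         dispersion (T n) (Kset phi nu k t1 eps s0 s1)
           @[n --> \oo] --> (0 : R)) ->
      [/\ integral_gap phi beta nu f (T n) @[n --> \oo] --> 0%E,
          upper_integral phi beta nu f (T n) @[n --> \oo]
            --> target_integral phi f &
          lower_integral phi beta nu f (T n) @[n --> \oo]
            --> target_integral phi f]).
Proof.
have fE : f = (fun x : R => x ^+ k) by apply/funext.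
subst f => {f_def}; pose f (x : R) := x ^+ k.
pose G (T : nat -> {fset R}) n := (\int[@lebesgue_measure R]_x
  (`|x| ^+ k * gap phi beta nu (T n) x)%:E)%E.
have absG T n : nested_grids t1 T -> (0 < n)%N ->
    `|integral_gap phi beta nu f (T n)|%E = G T n.
  move=> nT n0; have t1T := nested_grids_mem nT n0.
  rewrite (integral_gapE beta_gt0 nu_gt0 phi_bounds k t1T) gee0_abs//.
  apply: integral_ge0 => x _; rewrite lee_fin mulr_ge0 ?exprn_ge0//.
  by have /andP[] := gap_bounds beta_gt0 nu_gt0 phi_bounds t1T x.
have near_G eps delta T : 0 < eps -> 0 < delta -> nested_grids t1 T ->
    dispersion (T n) (Kset phi nu k t1 eps s0 s1) @[n --> \oo] --> (0 : R) ->
    \forall n \near \oo, (0 < n)%N /\ (G T n <= (eps + delta)%:E)%E.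
  move=> e0 d0 nT dK; near=> n; split; first by near: n; exact: nbhs_infty_gt.
  near: n; exact: (near_integral_gap_le phi_derivable phi'_continuous
    beta_continuous nu_continuous beta_gt0 nu_gt0 phi_bounds s0_gt0 s1_lt0 e0 nT dK d0).
have near_bounds eps delta T : 0 < eps -> 0 < delta -> nested_grids t1 T ->
    dispersion (T n) (Kset phi nu k t1 eps s0 s1) @[n --> \oo] --> (0 : R) ->
    eps + eps <= delta -> \forall n \near \oo,
    [/\ (`|integral_gap phi beta nu f (T n)| <= delta%:E)%E,
        (`|upper_integral phi beta nu f (T n)
            - target_integral phi f| <= delta%:E)%E &
        (`|lower_integral phi beta nu f (T n)
            - target_integral phi f| <= delta%:E)%E].
  (* The margin inside the compact set is taken equal to [eps], so the gap is eventually at most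
     [eps + eps]. *)
  move=> e0 d0 nT dK ed; apply: filterS (near_G _ _ _ e0 e0 nT dK) => n [n0 Gn].
  have {}Gn : (G T n <= delta%:E)%E by apply: le_trans Gn _; rewrite lee_fin.
  have t1T := nested_grids_mem nT n0; split.
  - by rewrite absG.
  - exact: le_trans (upper_integral_dist beta_gt0 nu_gt0 phi_bounds t1T I_finite) Gn.
  - exact: le_trans (lower_integral_dist beta_gt0 nu_gt0 phi_bounds t1T I_finite) Gn.
split; [|split].
- move=> eps T e0 [nT _ _ dK]; split.
    move=> n n0; have t1T := nested_grids_mem nT n0; split.
    + exact: integral_funrpos_gap_Kplus.
    + move=> _; split; first exact: integral_funrpos_gap_nneg.
      exact: integral_funrpos_gap_npos.
    + exact: integral_funrneg_gap_Kminus.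
  (* Strict positivity of the roots makes the claimed bound exceed [eps], leaving room for the
     integral over the compact set. *)
  have sqrt_gt0 C : 0 < C ->
      0 < Num.sqrt (2 * tangent_sigma nu t1 ^+ 2 * C / eps).
    move=> C0; have s20 : 0 < tangent_sigma nu t1 ^+ 2.
      by rewrite exprn_gt0// tangent_sigma_gt0.
    by rewrite sqrtr_gt0 divr_gt0// mulr_gt0// mulr_gt0.
  have := sqrt_gt0 _ (monomial_C_gt0 phi k s0 (nu_gt0 t1)).
  have := sqrt_gt0 _ (monomial_C_gt0 phi k s1 (nu_gt0 t1)).
  rewrite -(tilde_CE phi k (nu_gt0 t1) s0_gt0) -(hat_CE phi k (nu_gt0 t1) s1_lt0).
  rewrite /hat_sigma /tilde_sigma.
  set B1 := Num.sqrt _ => B1_gt0; set B0 := Num.sqrt _ => B0_gt0.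
  (* If tilde_mu is negative, it is dominated by |hat_mu|, as hat_mu <= tilde_mu. *)
  have mu_ge0 : 0 <= tilde_mu phi nu k t1 s0 + `|hat_mu phi nu k t1 s1|.
    have le_mu : hat_mu phi nu k t1 s1 <= tilde_mu phi nu k t1 s0.
      rewrite lerD2l; apply: ler_wpM2l; first by rewrite mulr_ge0// sqr_ge0.
      by apply: (@le_trans _ _ 0); rewrite ?invr_le0 ?invr_ge0 ltW.
    have := ler_norm (hat_mu phi nu k t1 s1).
    have := ler_norm (- hat_mu phi nu k t1 s1); rewrite normrN.
    set h := hat_mu _ _ _ _ _ in le_mu *; set N := `|h|; lra.
  set S := tilde_mu _ _ _ _ _ + _ in mu_ge0 *.
  (* The term [1] of the claimed bound pays for the outside of the compact set; this remainder is
     the margin inside. *)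
  have d0 : 0 < eps * (S + B1 + B0) by rewrite mulr_gt0//; lra.
  have [N _ hN] := near_G _ _ _ e0 d0 nT dK.
  (* The successor keeps the rank positive. *)
  exists N.+1; split => // n /ltnW nN; have [n0 Gn] := hN n nN.
  rewrite absG//; apply: (le_trans Gn); rewrite lee_fin -[X in X + _]mulr1 -mulrDr.
  by rewrite ler_pM2l// /S !addrA.
- move=> delta d0; near=> eps => T [nT _ _ dK].
  have e0 : 0 < eps by near: eps; exact: nbhs_right_gt.
  apply: near_bounds dK _ => //.
  have : eps < delta / 2 by near: eps; apply: nbhs_right_lt; rewrite divr_gt0.
  lra.
- move=> T nT dK.
  have half_gt0 (delta : R) : 0 < delta -> 0 < delta / 2 by move=> ?; lra.
  have le_half (delta : R) : delta / 2 + delta / 2 <= delta by lra.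
  have I_fin : target_integral phi f \is a fin_num.
    exact: integrable_fin_num.
  (* Here [eps] is [delta / 2], which varies with [delta]: the same grids fill the compact sets of
     every [eps]. *)
  have near_half (delta : R) (d0 : 0 < delta) :=
    near_bounds _ _ _ (half_gt0 _ d0) d0 nT (dK _ (half_gt0 _ d0)) (le_half delta).
  split.
  - apply: near_dist_le_cvge => [|delta d0]; first by [].
    by apply: filterS (near_half _ d0) => n [+ _ _]; rewrite sube0.
  - apply: near_dist_le_cvge => [|delta d0]; first exact: I_fin.
    by apply: filterS (near_half _ d0) => n [_ + _]; exact.
  - apply: near_dist_le_cvge => [|delta d0]; first exact: I_fin.
    by apply: filterS (near_half _ d0) => n [_ _ +]; exact.
Unshelve. all: by end_near. Qed.
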